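(* Let $(\mathcal{A},m)$ be a free multiarrangement in $V=\mathbb{K}^\ell$ with $\exp(\mathcal{A},m)=(d_1,\dots,d_\ell)$. Suppose $H_0\in\mathcal{A}$ is a heavy hyperplane with $m_0=m(H_0)$. Then: (1) $(\mathcal{A},m)$ has a good summand to $H_0$, and $m_0\in\exp(\mathcal{A},m)$. Write $\exp(\mathcal{A},m)=(m_0,d_2,\dots,d_\ell)$. (2) The Euler–Ziegler restriction $(\mathcal{A}^{H_0},m^{H_0})$ is free with $\exp(\mathcal{A}^{H_0},m^{H_0})=(d_2,\dots,d_\ell)$.
   Context: Let $\mathbb{K}$ be a field, $S=\mathbb{K}[x_1,\dots,x_\ell]$ and $V=\mathbb{K}^\ell$. A multiarrangement $(\mathcal{A},m)$ is a finite set of linear hyperplanes $H=\ker\alpha_H$ with multiplicity $m:\mathcal{A}\to\mathbb{Z}_{>0}$, and $|m|=\sum_Hm(H)$. $D(\mathcal{A},m)=\{\theta\in\mathrm{Der}_{\mathbb{K}}(S):\theta(\alpha_H)\in\alpha_H^{m(H)}S\ \forall H\}$. The multiarrangement is free if this is a free $S$-module; the exponents are the polynomial degrees of a homogeneous basis ($\theta$ has polynomial degree $d$ if all $\theta(x_i)$ are $0$ or homogeneous of degree $d$). The same notions apply in $H_0$, with coordinate ring $S/\alpha_{H_0}S$. $H_0$ is heavy if $2m(H_0)\ge|m|$. The Euler–Ziegler restriction is $\mathcal{A}^{H_0}=\{H_0\cap H:H\in\mathcal{A}\setminus\{H_0\}\}$ with $m^{H_0}(X)=\sum_{H\in\mathcal{A}_X\setminus\{H_0\}}m(H)$,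 where $\mathcal{A}_X=\{H:X\subseteq H\}$. A good summand to $H_0$ is a homogeneous $\theta_0\in D(\mathcal{A},m)$ of polynomial degree $m(H_0)$ with $\theta_0(\alpha_{H_0})=\alpha_{H_0}^{m(H_0)}$. *)

(* Defs.v *)
From HB Require Import structures.
From mathcomp Require Import all_boot all_order all_algebra.
From mathcomp Require Import mpoly.
Set Implicit Arguments. Unset Strict Implicit. Unset Printing Implicit Defensive.
Import GRing.Theory.
Local Open Scope ring_scope.

Section MultiArr.
Variable K : fieldType.

(* A derivation of S = K[x_1..x_n] (S-linear combination of the d/dx_i),
   encoded by the tuple of its values theta(x_i). *)
Definition der (n : nat) := 'I_n -> {mpoly K[n]}.

Definition lin_form n (a : 'rV[K]_n) : {mpoly K[n]} := \sum_(i < n) a 0 i *: 'X_i.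

(* theta(alpha) for a linear form alpha : theta(sum a_i x_i) = sum a_i theta(x_i) *)
Definition der_app n (th : der n) (a : 'rV[K]_n) : {mpoly K[n]} :=
  \sum_(i < n) a 0 i *: th i.

Definition mdivides n (p q : {mpoly K[n]}) : Prop := exists r, q = p * r.

Definition homog_deg n (d : nat) (p : {mpoly K[n]}) : bool :=
  all (fun mo : 'X_{1..n} => mdeg mo == d) (msupp p).

Definition der_pdeg n (d : nat) (th : der n) : Prop := forall i, homog_deg d (th i).

(* D(A,m) for a multiarrangement given by linear forms alpha_j (j : 'I_k, j selected
   by sel) with multiplicities mu_j :
   theta(alpha_j) in alpha_j^(mu_j) S *)
Definition inD n k (alpha : 'I_k -> 'rV[K]_n) (mu : 'I_k -> nat) (sel : pred 'I_k)
  (th : der n) : Prop :=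
  forall j, sel j -> mdivides (lin_form (alpha j) ^+ mu j) (der_app th (alpha j)).

Definition free_with_exp n (M : der n -> Prop) (d : seq nat) : Prop :=
  size d = n /\
  exists B : 'I_n -> der n,
    [/\ forall j : 'I_n, M (B j),
        forall j : 'I_n, der_pdeg (nth 0%N d j) (B j),
        forall th, M th -> exists c : 'I_n -> {mpoly K[n]},
            forall i, th i = \sum_(j < n) c j * B j i
      & forall c : 'I_n -> {mpoly K[n]},
            (forall i, \sum_(j < n) c j * B j i = 0) -> forall j, c j = 0].

Definition same_hyp n (a b : 'rV[K]_n) : bool := (kermx a^T == kermx b^T)%MS.

(* Euler--Ziegler restriction multiplicity of X = H_j \cap H_0, computed after
   pulling back along coordinates P of H_0 (beta_j = alpha_j restricted to H_0) *)
Definition ez_mult n k (beta : 'I_k -> 'rV[K]_n) (m : 'I_k -> nat) (i0 : 'I_k) (j : 'I_k) :=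
  (\sum_(h < k | (h != i0) && same_hyp (beta h) (beta j)) m h)%N.

End MultiArr.

(* Main.v *)
(* With Q the product of the alpha_H^m(H), the determinant of a basis of D(A,m) divides Q (Saito),
   so the exponents sum to at most |m| <= 2 m0. Write theta_i(alpha_0) = alpha_0^m0 f_i: here f_i is
   zero if d_i < m0 and constant if d_i = m0, while at most one d_i exceeds m0. If no f_i is a unit,
   then a single f_i is nonzero; it divides theta(alpha_0) / alpha_0^m0 for every theta in D(A,m).
   Testing it on explicit derivations shows that it divides Q / alpha_0^m0 and is prime to each
   alpha_H with H <> H_0, so it is a unit after all.
   Subtracting multiples of that theta_i makes the other basis elements kill alpha_0; expanding
   the determinant, their restrictions to H_0 have a determinant dividing (Q / alpha_0^m0)|H_0.
   That polynomial divides the determinant of any family in the restricted module, so by Cramer's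
   rule the restrictions form a basis. *)
Require Import Defs.
From HB Require Import structures.
From mathcomp Require Import all_boot all_order all_algebra.
From mathcomp Require Import mpoly.
Import GRing.Theory.
Local Open Scope ring_scope.

Set Implicit Arguments. Unset Strict Implicit. Unset Printing Implicit Defensive.

(** * Divisibility and units in the polynomial ring *)

Section Divisibility.
Variables (K : fieldType) (n : nat).
Implicit Types p q r : {mpoly K[n]}.

Lemma mdivides_refl p : mdivides p p.
Proof. by exists 1; rewrite mulr1. Qed.

Lemma mdivides0 p : mdivides p 0.
Proof. by exists 0; rewrite mulr0. Qed.

Lemma mdivides1 p : mdivides 1 p.
Proof. by exists p; rewrite mul1r. Qed.

Lemma mdivides_mull p q r : mdivides p q -> mdivides p (r * q).
Proof. by case=> s ->; exists (r * s); rewrite mulrCA. Qed.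

Lemma mdivides_mulr p q r : mdivides p q -> mdivides p (q * r).
Proof. by rewrite mulrC; apply: mdivides_mull. Qed.

Lemma mdividesZ p q c : mdivides p q -> mdivides p (c *: q).
Proof. by rewrite -mul_mpolyC; apply: mdivides_mull. Qed.

Lemma mdividesD p q r : mdivides p q -> mdivides p r -> mdivides p (q + r).
Proof. by case=> s -> [t ->]; exists (s + t); rewrite mulrDr. Qed.

Lemma mdividesB p q r : mdivides p q -> mdivides p r -> mdivides p (q - r).
Proof. by case=> s -> [t ->]; exists (s - t); rewrite mulrBr. Qed.

Lemma mdivides_trans p q r : mdivides p q -> mdivides q r -> mdivides p r.
Proof. by case=> s -> [t ->]; exists (s * t); rewrite mulrA. Qed.

Lemma mdivides_sum p (I : finType) (F : I -> {mpoly K[n]}) :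
  (forall i, mdivides p (F i)) -> mdivides p (\sum_i F i).
Proof.
move=> pF; elim/big_ind: _ => //; first exact: mdivides0.
exact: mdividesD.
Qed.

Lemma mdivides_mul2l p q r : p != 0 -> mdivides (p * q) (p * r) -> mdivides q r.
Proof. by move=> p0 [s]; rewrite -mulrA => /(mulfI p0) ->; exists s. Qed.

Lemma unit_mdivides_unit p q : mdivides p q -> q \is a GRing.unit -> p \is a GRing.unit.
Proof. by case=> s ->; rewrite unitrM => /andP[]. Qed.

Lemma mdivides_unitM p q u : u \is a GRing.unit -> mdivides p (u * q) -> mdivides p q.
Proof. by move=> uU /(mdivides_mull u^-1); rewrite mulKr. Qed.

Lemma mpoly_unitP p : reflect (exists2 c, c != 0 & p = c%:MP) (p \is a GRing.unit).
Proof.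
apply: (iffP idP) => [/andP[/eqP pE] | [c c0 ->]].
  by rewrite unitfE => ?; exists p@_0.
by apply: rmorph_unit; rewrite unitfE.
Qed.

End Divisibility.

(** * Linear forms: primality and proportionality *)

Section LinearForms.
Variables (K : fieldType) (n : nat).
Implicit Types (a b v : 'rV[K]_n) (p q : {mpoly K[n]}).

Definition dot a v : K := \sum_i a 0 i * v 0 i.

Lemma dotE a v : v *m a^T = (dot a v)%:M.
Proof.
apply/matrixP=> i j; rewrite !ord1 !mxE eqxx mulr1n.
by apply: eq_bigr => s _; rewrite mxE mulrC.
Qed.

Lemma lin_formE a p i : p = lin_form a -> p@_U_(i) = a 0 i.
Proof.
move=> ->; rewrite raddf_sum (bigD1 i) //= mcoeffZ mcoeffXU eqxx mulr1.
rewrite big1 ?addr0 // => j /negbTE ji.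
by rewrite mcoeffZ mcoeffXU ji mulr0.
Qed.

Lemma lin_form_inj : injective (@lin_form K n).
Proof. by move=> a b ab; apply/rowP => i; rewrite -(lin_formE i ab) (lin_formE i erefl). Qed.

Lemma lin_form0 : lin_form (0 : 'rV[K]_n) = 0.
Proof. by apply: big1 => i _; rewrite mxE scale0r. Qed.

Lemma lin_form_eq0 a : (lin_form a == 0) = (a == 0).
Proof. by rewrite -lin_form0 (inj_eq lin_form_inj). Qed.

Lemma lin_formZ c a : lin_form (c *: a) = c *: lin_form a.
Proof. by rewrite scaler_sumr; apply: eq_bigr => i _; rewrite mxE scalerA. Qed.

Lemma lin_form_homog a : lin_form a \is 1.-homog.
Proof. by apply: rpred_sum => i _; apply: dhomogZ; rewrite dhomogX; apply/eqP/mdeg1. Qed.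

Lemma exists_dot1 a : a != 0 -> exists v, dot a v = 1.
Proof.
case/rV0Pn=> i ai; exists ((a 0 i)^-1 *: delta_mx 0 i).
rewrite /dot (bigD1 i) //= big1 => [|j /negbTE ji].
  by rewrite !mxE !eqxx mulr1 mulfV ?addr0.
by rewrite !mxE eqxx ji !mulr0.
Qed.

(** For [dot a v = 1] this is pullback along the projection of V onto ker a in direction v. It
    models reduction modulo [lin_form a] inside the polynomial ring itself. *)
Definition shear a v p := p \mPo [tuple 'X_i - v 0 i *: lin_form a | i < n].

HB.instance Definition _ a v := GRing.RMorphism.copy (shear a v)
  (comp_mpoly [tuple 'X_i - v 0 i *: lin_form a | i < n]).

Lemma shear_lin_form a v b : shear a v (lin_form b) = lin_form b - dot b v *: lin_form a.
Proof.
rewrite /shear raddf_sum /= scaler_suml -sumrB; apply: eq_bigr => i _.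
by rewrite comp_mpolyZ comp_mpolyXU -tnth_nth tnth_mktuple scalerBr scalerA.
Qed.

(** Each variable changes by a multiple of [lin_form a], and congruence modulo that form respects
    sums and products. *)
Lemma mdivides_subr_shear a v p : mdivides (lin_form a) (p - shear a v p).
Proof.
pose D q := mdivides (lin_form a) (q - shear a v q).
have mulP q r : D q -> D r -> D (q * r).
  move=> qP rP; rewrite /D rmorphM /=.
  rewrite [_ - _](_ : _ = (q - shear a v q) * r + shear a v q * (r - shear a v r)).
    by apply: mdividesD; [apply: mdivides_mulr | apply: mdivides_mull].
  by rewrite mulrBl mulrBr addrA subrK.
have oneP : D 1 by rewrite /D rmorph1 subrr; apply: mdivides0.
have varP i : D 'X_i.
  rewrite /D /shear comp_mpolyXU -tnth_nth tnth_mktuple opprB addrCA subrr addr0.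
  by apply: mdividesZ; apply: mdivides_refl.
elim/mpolyind: p => [|c m p _ _ IH]; first by rewrite rmorph0 subrr; apply: mdivides0.
rewrite rmorphD /= opprD addrACA; apply: mdividesD; last exact: IH.
rewrite -mul_mpolyC; apply: (mulP).
  by rewrite /D /shear comp_mpolyC subrr; apply: mdivides0.
rewrite [X in D X]mpolyXE_id; apply: (big_ind D oneP mulP) => i _.
elim: (m i) => [|k IHk]; first by rewrite expr0.
by rewrite exprS; apply: mulP.
Qed.

Lemma lin_form_mdividesE a v p :
  dot a v = 1 -> mdivides (lin_form a) p <-> shear a v p = 0.
Proof.
move=> av; split=> [[r ->]|p0]; last by have := mdivides_subr_shear a v p; rewrite p0 subr0.
by rewrite rmorphM /= shear_lin_form av scale1r subrr mul0r.
Qed.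

(** Divisibility by the form means vanishing under [shear a v], a ring morphism into an integral
    domain. *)
Lemma lin_form_prime a p q : a != 0 ->
  mdivides (lin_form a) (p * q) -> mdivides (lin_form a) p \/ mdivides (lin_form a) q.
Proof.
case/exists_dot1=> v av /(lin_form_mdividesE _ av); rewrite rmorphM /=.
move=> /eqP; rewrite mulf_eq0 => /orP[] /eqP ?; [left|right]; exact/(lin_form_mdividesE _ av).
Qed.

Lemma lin_form_not_unit a : a != 0 -> ~ mdivides (lin_form a) 1.
Proof.
by case/exists_dot1=> v av /(lin_form_mdividesE _ av); rewrite rmorph1 => /eqP; rewrite oner_eq0.
Qed.

Lemma same_hypP a b : a != 0 -> b != 0 ->
  reflect (exists2 c, c != 0 & b = c *: a) (same_hyp a b).
Proof.
move=> a0 b0; apply: (iffP idP) => [/eqmxP ab|[c c0 ->]]; last first.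
  rewrite /same_hyp linearZ /=; apply/andP; split; apply/sub_kermxP.
    by rewrite -scalemxAr mulmx_ker scaler0.
  by apply: (scalerI c0); rewrite scalemxAr mulmx_ker scaler0.
have [v av] := exists_dot1 a0.
(* [1%:M - a^T *m v] projects onto ker a along v, so b vanishes on its rows; this reads b =
   [dot b v *: a]. *)
have : (1%:M - a^T *m v <= kermx b^T)%MS.
  rewrite -ab; apply/sub_kermxP.
  by rewrite mulmxBl mul1mx -mulmxA dotE av mulmx1 subrr.
move/sub_kermxP; rewrite mulmxBl mul1mx -mulmxA dotE mul_mx_scalar => /eqP.
rewrite subr_eq0 -linearZ /= => /eqP /trmx_inj bE; exists (dot b v) => //.
by apply: contraNneq b0 => c0; rewrite bE c0 scale0r.
Qed.

Lemma mdivides_lin_form a b : a != 0 -> b != 0 ->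
  mdivides (lin_form a) (lin_form b) -> same_hyp a b.
Proof.
move=> a0 b0; have [v av] := exists_dot1 a0.
move/(lin_form_mdividesE _ av)=> /eqP; rewrite shear_lin_form subr_eq0 -lin_formZ.
move/eqP/lin_form_inj => bE; apply/same_hypP=> //; exists (dot b v) => //.
by apply: contraNneq b0 => c0; rewrite bE c0 scale0r.
Qed.

End LinearForms.

(** * Defining polynomials and divisibility by them *)

Section DefiningPolynomial.
Variables (K : fieldType) (n k : nat) (a : 'I_k -> 'rV[K]_n).
Implicit Types (m : 'I_k -> nat) (P : pred 'I_k) (p q : {mpoly K[n]}).

Definition defpoly m P : {mpoly K[n]} := \prod_(j | P j) lin_form (a j) ^+ m j.

Lemma same_hyp_refl (b : 'rV[K]_n) : same_hyp b b.
Proof. exact/eqmxP. Qed.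

Lemma same_hyp_sym (b c : 'rV[K]_n) : same_hyp b c = same_hyp c b.
Proof. by apply/eqmxP/eqmxP => /eqmx_sym. Qed.

Lemma same_hyp_trans (b c e : 'rV[K]_n) : same_hyp b c -> same_hyp c e -> same_hyp b e.
Proof. by move=> /eqmxP bc /eqmxP ce; apply/eqmxP; apply: eqmx_trans ce. Qed.

Lemma eq_defpoly m P P' : P =1 P' -> defpoly m P = defpoly m P'.
Proof. exact: eq_bigl. Qed.

Lemma defpolyD1 m P j : P j ->
  defpoly m P = lin_form (a j) ^+ m j * defpoly m (fun h => P h && (h != j)).
Proof. exact: bigD1. Qed.

Lemma defpoly_neq0 m P : (forall j, P j -> a j != 0) -> defpoly m P != 0.
Proof.
move=> a0; apply: (big_ind (fun p => p != 0)) => [|p q|j Pj]; first exact: oner_neq0.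
  exact: mulf_neq0.
by rewrite expf_neq0 // lin_form_eq0 a0.
Qed.

Lemma defpoly_homog m P : defpoly m P \is (\sum_(j | P j) m j)%N.-homog.
Proof.
apply: (big_ind2 (fun p d => p \is d.-homog)) => [|p d q e|j Pj]; first exact: dhomog1.
  exact: dhomogM.
by have := dhomogMn (m j) (lin_form_homog (a j)); rewrite mul1n.
Qed.

Lemma not_mdivides_defpoly m P b : b != 0 ->
  (forall j, P j -> a j != 0) -> (forall j, P j -> ~~ same_hyp b (a j)) ->
  ~ mdivides (lin_form b) (defpoly m P).
Proof.
move=> b0 a0 ba; apply: (big_ind (fun p => ~ mdivides (lin_form b) p)) => [|p q bp bq|j Pj].
- exact: lin_form_not_unit.
- by case/(lin_form_prime b0).
elim: (m j) => [|r IH]; first by rewrite expr0; apply: lin_form_not_unit.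
rewrite exprS => /(lin_form_prime b0)[] // /(mdivides_lin_form b0 (a0 j Pj)).
exact/negP/ba.
Qed.

Lemma mdivides_expM_cancel b r p q : b != 0 -> ~ mdivides (lin_form b) p ->
  mdivides (lin_form b ^+ r) (p * q) -> mdivides (lin_form b ^+ r) q.
Proof.
move=> b0 bp; elim: r q => [|r IH] q; first by rewrite expr0 => _; apply: mdivides1.
rewrite exprS => bpq.
have [|/bp//|[s qE]] := @lin_form_prime _ _ b p q b0.
  by apply: mdivides_trans bpq; exists (lin_form b ^+ r).
move: bpq; rewrite {}qE mulrCA => /mdivides_mul2l; rewrite lin_form_eq0 => /(_ b0) /IH [t ->].
by exists t; rewrite mulrA.
Qed.

(** Each factor is a power of a prime not dividing p, so the factors pass to q one at a time.
    Hyperplanes may repeat, as happens after restriction. *)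
Lemma defpoly_mdivides_cancel m P p q :
  (forall j, P j -> a j != 0) -> (forall j, P j -> ~ mdivides (lin_form (a j)) p) ->
  mdivides (defpoly m P) (p * q) -> mdivides (defpoly m P) q.
Proof.
rewrite /defpoly => a0 ap; elim: (index_enum _) q => [|j s IH] q.
  by rewrite big_nil => _; apply: mdivides1.
rewrite big_cons; case: ifP => [Pj|_]; last exact: IH.
move=> jspq; have [|t qE] := mdivides_expM_cancel (r := m j) (a0 j Pj) (ap j Pj) (q := q).
  by apply: mdivides_trans jspq; eexists.
move: jspq; rewrite {}qE mulrCA => /mdivides_mul2l.
rewrite expf_neq0 ?lin_form_eq0 ?a0 // => /(_ isT) /IH [u ->].
by exists u; rewrite mulrA.
Qed.

(* Distinct parallelism classes are coprime, so divisibility may be tested class by class. *)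
Lemma defpoly_mdivides_classes m P q :
  (forall j, P j -> a j != 0) ->
  (forall j, P j -> mdivides (defpoly m (fun h => P h && same_hyp (a h) (a j))) q) ->
  mdivides (defpoly m P) q.
Proof.
have [r] := ubnP #|P|; elim: r P q => // r IH P q /ltnSE Pr a0 Pq.
have [/existsP[j Pj]|P0] := boolP [exists j, P j]; last first.
  rewrite /defpoly big_pred0; first exact: mdivides1.
  by move=> j; apply/negbTE; apply: contra P0 => Pj; apply/existsP; exists j.
pose P' h := P h && ~~ same_hyp (a h) (a j).
rewrite /defpoly (bigID (fun h => same_hyp (a h) (a j))) /= -/(defpoly m P').
have [s qE] := Pq j Pj; rewrite qE.
suff [t ->] : mdivides (defpoly m P') s by eexists; rewrite mulrA.
apply: IH => [|h /andP[/a0 //]|h /andP[Ph hj]].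
  apply: leq_trans Pr; apply: proper_card; apply/properP; split.
    by apply/subsetP => h; rewrite !unfold_in => /andP[].
  by exists j => //; rewrite unfold_in /P' same_hyp_refl andbF.
(* Since h is outside the class of j, removing that class leaves the class of h intact. *)
have -> : defpoly m (fun i => P' i && same_hyp (a i) (a h)) =
          defpoly m (fun i => P i && same_hyp (a i) (a h)).
  apply: eq_defpoly => i; rewrite /P' -andbA; congr (_ && _).
  have [ih|] := boolP (same_hyp (a i) (a h)); rewrite (andbT, andbF) //.
  apply: contra hj => ij; apply: same_hyp_trans ij; by rewrite same_hyp_sym.
apply: defpoly_mdivides_cancel (defpoly m (fun i => P i && same_hyp (a i) (a j))) _ _ _ _.
- by move=> i /andP[/a0].
- move=> i /andP[Pi ih]; apply: not_mdivides_defpoly; first exact: a0.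
    by move=> i' /andP[/a0].
  move=> i' /andP[Pi' i'j]; apply: contra hj => ii'.
  by apply: same_hyp_trans i'j; apply: same_hyp_trans ii'; rewrite same_hyp_sym.
by rewrite -qE; apply: Pq.
Qed.

End DefiningPolynomial.

(** Multiply the column of values [der_app (N i) a] by the adjugate: entry r is [a 0 r *: \det N],
    and [a 0 r] is a nonzero scalar for a suitable r. *)
Lemma mdivides_det (K : fieldType) n (N : 'M[{mpoly K[n]}]_n) (a : 'rV[K]_n) q :
  a != 0 -> (forall i, mdivides q (der_app (N i) a)) -> mdivides q (\det N).
Proof.
case/rV0Pn=> r ar qN.
have arE : a 0 r *: \det N = \sum_i \adj N r i * der_app (N i) a.
  under eq_bigr => i _ do rewrite mulr_sumr.
  rewrite exchange_big /= (bigD1 r) //= [X in _ + X]big1 => [|s /negbTE sr].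
    under eq_bigr => i _ do rewrite -scalerAr.
    rewrite -scaler_sumr addr0; congr (_ *: _).
    by have /matrixP/(_ r r) := mul_adj_mx N; rewrite !mxE eqxx mulr1n => <-.
  under eq_bigr => i _ do rewrite -scalerAr.
  rewrite -scaler_sumr; have /matrixP/(_ r s) := mul_adj_mx N.
  by rewrite !mxE eq_sym sr mulr0n => ->; rewrite scaler0.
rewrite -[\det N](scalerK ar) arE; apply: mdividesZ; apply: mdivides_sum => i.
exact: mdivides_mull.
Qed.

(** * Saito's criterion: the determinant of a basis and the defining polynomial *)

Section Saito.
Variables (K : fieldType) (n k : nat) (a : 'I_k -> 'rV[K]_n.+1) (m : 'I_k -> nat).
Hypothesis a0 : forall j, a j != 0.
Hypothesis a_inj : forall i j, i != j -> ~~ same_hyp (a i) (a j).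

Lemma der_appZ (th : der K n.+1) c b :
  der_app (fun i => c * th i) b = c * der_app th b.
Proof. by rewrite mulr_sumr; apply: eq_bigr => i _; rewrite scalerAr. Qed.

Lemma defpoly_mdivides (P : pred 'I_k) q :
  (forall j, P j -> mdivides (lin_form (a j) ^+ m j) q) -> mdivides (defpoly a m P) q.
Proof.
move=> Pq; apply: defpoly_mdivides_classes => [j _|j Pj]; first exact: a0.
rewrite /defpoly (big_pred1 j); first exact: Pq.
move=> h /=; apply/andP/eqP => [[_]|->]; last by split=> //; apply: same_hyp_refl.
by apply: contraTeq; apply: a_inj.
Qed.

Variable B : 'M[{mpoly K[n.+1]}]_n.+1.
Hypothesis BD : forall i, inD a m predT (B i).
Hypothesis B_gen : forall th, inD a m predT th ->
  exists c : 'I_n.+1 -> {mpoly K[n.+1]}, forall i, th i = \sum_j c j * B j i.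

(** On determinants: [\det B] divides the determinant of every square family in D(A,m). *)
Lemma gen_mul (E : 'M[{mpoly K[n.+1]}]_n.+1) :
  (forall i, inD a m predT (E i)) -> exists C, E = C *m B.
Proof.
move=> ED; have [c cE] := fin_all_exists (fun i => B_gen (ED i)).
exists (\matrix_(i, j) c i j); apply/matrixP => i j; rewrite cE mxE.
by apply: eq_bigr => s _; rewrite mxE.
Qed.

(* The gcd of the determinants of all (l x l)-families in D(A,m) is Q: besides Q.1, use for
   each H a family with determinant Q (Q / alpha_H^m_H)^(l-1). *)
Lemma det_basis_mdivides : mdivides (\det B) (defpoly a m predT).
Proof.
set Q := defpoly a m predT.
have Q0 : Q != 0 by apply: defpoly_neq0.
have [g gE] : mdivides Q (\det B).
  by apply: defpoly_mdivides => j _; apply: (mdivides_det (a0 j)) => i; apply: BD.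
(* The quotient g of [\det B] by Q will divide [Q' ^+ n], which involves only the other
   hyperplanes. *)
have ag j : ~ mdivides (lin_form (a j)) g.
  pose q := lin_form (a j) ^+ m j; pose Q' := defpoly a m (fun h => predT h && (h != j)).
  have QE : Q = q * Q' by apply: defpolyD1.
  have [r ajr] := rV0Pn _ (a0 j).
  (* Row r is q d/dx_r; the other rows d/dx_i - (a_i/a_r) d/dx_r kill the form of [a j]. Multiplying
     by Q' takes care of the remaining hyperplanes. *)
  pose G : 'M[{mpoly K[n.+1]}]_n.+1 := \matrix_(i, s) if i == r then q * (s == r)%:R
    else (i == s)%:R - (a j 0 i / a j 0 r) *: (s == r)%:R.
  have detG : \det G = q.
    rewrite (expand_det_row _ r) (bigD1 r) //= big1 => [|s /negbTE sr]; last first.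
      by rewrite !mxE eqxx sr mulr0 mul0r.
    rewrite !mxE !eqxx mulr1 addr0 /cofactor addnn -signr_odd odd_double mul1r.
    rewrite [X in \det X](_ : _ = 1%:M) ?det1 ?mulr1 //.
    have liftF i : (lift r i == r) = false by rewrite eq_sym; apply/negbTE/neq_lift.
    by apply/matrixP => i s; rewrite !mxE !liftF scaler0 subr0 (inj_eq lift_inj).
  have GD i : inD a m predT (fun s => Q' * G i s).
    move=> h _; rewrite der_appZ; have [-> {h}|hj] := eqVneq h j; last first.
      apply: mdivides_mulr; exists (defpoly a m (fun h' => (predT h' && (h' != j)) && (h' != h))).
      by apply: defpolyD1; rewrite hj.
    apply: mdivides_mull; rewrite /der_app.
    have [-> {i}|ir] := eqVneq i r.
      apply: mdivides_sum => s; rewrite mxE eqxx; apply: mdividesZ.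
      exact/mdivides_mulr/mdivides_refl.
    rewrite (bigD1 r) //= (bigD1 i) //= big1 => [|s /andP[/negbTE sr /negbTE si]].
      rewrite !mxE !(negbTE ir) !eqxx addr0 sub0r scaler0 subr0 scalerN scalerA.
      by rewrite mulrC mulfVK // addNr; apply: mdivides0.
    by rewrite !mxE (negbTE ir) sr [i == s]eq_sym si scaler0 subr0 scaler0.
  have [|C CE] := @gen_mul (Q' *: G).
    move=> i h hT; have [t tE] := GD i h hT; exists t; rewrite -tE.
    by apply: eq_bigr => s _; rewrite mxE.
  have : \det (Q' *: G) = \det C * \det B by rewrite CE det_mulmx.
  rewrite detZ detG gE => CQ.
  have gQ' : mdivides g (Q' ^+ n).
    exists (\det C); apply: (mulfI Q0); rewrite mulrA [RHS]mulrC -CQ exprS QE.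
    by rewrite -!mulrA [LHS]mulrC -!mulrA; congr (_ * _); rewrite mulrC.
  move=> /mdivides_trans/(_ gQ'); rewrite /Q' /defpoly -prodrXl.
  under eq_bigr => i _ do rewrite -exprM.
  apply: (@not_mdivides_defpoly _ _ _ a (fun i => (m i * n)%N)) => [|//|h /= hj]; first exact: a0.
  by apply: a_inj; rewrite eq_sym.
(* Here Q^(n+1) = det C * Q * g, so Q^n = g * det C. As g is prime to all the forms, Q^n divides det
   C, which forces g to be a unit. *)
have [|C CE] := @gen_mul (Q%:M).
  move=> i j _; exists (a j 0 i *: defpoly a m (fun h => predT h && (h != j))).
  rewrite /der_app (bigD1 i) //= big1 => [|s /negbTE si]; last first.
    by rewrite mxE [i == s]eq_sym si mulr0n scaler0.
  by rewrite mxE eqxx addr0 mulr1n /Q (@defpolyD1 _ _ _ _ _ _ j) // scalerAr.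
have gC : mdivides (Q ^+ n) (g * \det C).
  suff <- : Q ^+ n = g * \det C by apply: mdivides_refl.
  by apply: (mulfI Q0); rewrite -exprS -det_scalar CE det_mulmx gE mulrC mulrA.
have : mdivides (Q ^+ n) (\det C).
  move: gC; rewrite /Q /defpoly -prodrXl.
  under eq_bigr => i _ do rewrite -exprM.
  exact: (@defpoly_mdivides_cancel _ _ _ a (fun i => (m i * n)%N)).
case=> t tE; exists t; apply: (mulfI (expf_neq0 n Q0)); rewrite gE.
rewrite -exprSr -det_scalar CE det_mulmx tE gE.
by rewrite -!mulrA; congr (_ * _); rewrite mulrCA; congr (_ * _); rewrite mulrC.
Qed.

End Saito.

(** * Homogeneous polynomials, quotients and determinants *)

Section Homogeneity.
Variables (K : fieldType) (n : nat).
Implicit Types (p q : {mpoly K[n]}) (d e : nat).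

Lemma homog_degE d p : homog_deg d p = (p \is d.-homog).
Proof. by []. Qed.

Lemma dhomog0_unit p : p \is 0.-homog -> p != 0 -> p \is a GRing.unit.
Proof.
move=> p_hom p0; have /msize1_polyC pE : (msize p <= 1)%N.
  rewrite msizeE; apply/bigmax_leqP_seq => m mp _.
  by rewrite [mdeg m](dhomog_mf p_hom mp).
apply/mpoly_unitP; exists p@_0 => //.
by apply: contraNneq p0 => c0; rewrite pE c0 mpolyC0.
Qed.

Lemma pihomogM e q k p : q \is e.-homog ->
  pihomog mdeg (e + k) (q * p) = q * pihomog mdeg k p.
Proof.
move=> q_hom; elim/mpolyind: p => [|c m p _ _ IH]; first by rewrite mulr0 !pihomog0 mulr0.
rewrite mulrDr !pihomogD mulrDr {}IH; congr (_ + _).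
rewrite -scalerAr !linearZ /= -scalerAr; congr (_ *: _).
have qm_hom : q * 'X_[m] \is (e + mdeg m).-homog by apply: dhomogM; rewrite ?dhomogX.
rewrite pihomogX /=; case: eqP => [<-|/eqP mk]; first exact: pihomog_dE.
by rewrite (pihomog_ne0 _ qm_hom) ?mulr0 // eqn_add2l.
Qed.

(** Multiplication by the homogeneous q shifts homogeneous components by e, so every nonzero
    component of p lies in the single degree d - e. *)
Lemma dhomog_mul_cancel e d q p : q != 0 -> p != 0 -> q \is e.-homog ->
  q * p \is d.-homog -> (e <= d)%N /\ p \is (d - e).-homog.
Proof.
move=> q0 p0 q_hom qp_hom.
have degE k : pihomog mdeg k p != 0 -> (e + k)%N = d.
  apply: contraNeq => ek; apply/eqP/(mulfI q0).
  by rewrite -(pihomogM _ _ q_hom) mulr0 (pihomog_ne0 _ qp_hom) // eq_sym.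
have pE := pihomog_partitionE (leqnn (mmeasure mdeg p)); split.
  have [/existsP[k /degE <-]|/existsPn no] :=
    boolP [exists k : 'I_(mmeasure mdeg p), pihomog mdeg k p != 0].
    exact: leq_addr.
  by case/eqP: p0; rewrite pE big1 // => k _; apply/eqP; have := no k; rewrite negbK.
rewrite pE; apply: rpred_sum => k _.
have [->|/degE <-] := eqVneq (pihomog mdeg k p) 0; first exact: dhomog0.
by rewrite addKn; apply: pihomogP.
Qed.

Lemma dhomog_det r (N : 'M[{mpoly K[n]}]_r) (d : 'I_r -> nat) :
  (forall i j, N i j \is (d i).-homog) -> \det N \is (\sum_i d i)%N.-homog.
Proof.
move=> N_hom; apply: rpred_sum => s _; rewrite rpredMsign.
apply: (big_ind2 (fun p e => p \is e.-homog)) => [|p e q e'|i _] //; first exact: dhomog1.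
exact: dhomogM.
Qed.

Lemma dhomog_der_app d (th : der K n) a : der_pdeg d th -> der_app th a \is d.-homog.
Proof. by move=> th_hom; apply: rpred_sum => i _; apply: dhomogZ; apply: th_hom. Qed.

End Homogeneity.

(** * Values of derivations on linear forms *)

Section Derivations.
Variables (K : fieldType) (n : nat).

Lemma der_app_comb r (c : 'I_r -> {mpoly K[n]}) (B : 'I_r -> der K n) (th : der K n) a :
  (forall i, th i = \sum_j c j * B j i) -> der_app th a = \sum_j c j * der_app (B j) a.
Proof.
move=> thE; under [RHS]eq_bigr => j _ do rewrite mulr_sumr.
rewrite exchange_big; apply: eq_bigr => i _; rewrite thE scaler_sumr.
by apply: eq_bigr => j _; rewrite scalerAr.
Qed.

Lemma der_app_const q (v a : 'rV[K]_n) : der_app (fun i => v 0 i *: q) a = dot a v *: q.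
Proof. by rewrite scaler_suml; apply: eq_bigr => i _; rewrite scalerA. Qed.

(** With [dot b w = 1], non-proportionality makes [a - dot a w *: b] nonzero; a vector where it
    equals 1, moved along w into ker b, works. It provides constant derivations that kill one form
    but not the other. *)
Lemma exists_dot10 (a b : 'rV[K]_n) : a != 0 -> b != 0 -> ~~ same_hyp a b ->
  exists v, dot a v = 1 /\ dot b v = 0.
Proof.
move=> a0 b0 ab; have [w bw] := exists_dot1 b0.
have : a - dot a w *: b != 0.
  apply: contra ab => /eqP/subr0_eq aE; rewrite same_hyp_sym; apply/same_hypP => //.
  by exists (dot a w) => //; apply: contraNneq a0 => c0; rewrite aE c0 scale0r.
case/exists_dot1=> v cv; exists (v - dot b v *: w).
have dotB c : dot c (v - dot b v *: w) = dot c v - dot b v * dot c w.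
  rewrite /dot mulr_sumr -sumrB; apply: eq_bigr => i _; rewrite !mxE mulrBr; congr (_ - _).
  by rewrite mulrCA.
rewrite !dotB bw mulr1 subrr -cv; split=> //.
rewrite /dot [_ * \sum_i a 0 i * _]mulrC !mulr_sumr -sumrB; apply: eq_bigr => i _.
by rewrite !mxE mulrBl mulrA.
Qed.

End Derivations.

(** * A heavy hyperplane forces a good basis element *)

Section Heavy.
Variables (K : fieldType) (n k : nat) (a : 'I_k -> 'rV[K]_n.+1) (m : 'I_k -> nat).
Hypothesis a0 : forall j, a j != 0.
Hypothesis a_inj : forall i j, i != j -> ~~ same_hyp (a i) (a j).
Variables (B : 'M[{mpoly K[n.+1]}]_n.+1) (d : 'I_n.+1 -> nat) (i0 : 'I_k).
Hypothesis BD : forall i, inD a m predT (B i).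
Hypothesis B_gen : forall th, inD a m predT th ->
  exists c : 'I_n.+1 -> {mpoly K[n.+1]}, forall i, th i = \sum_j c j * B j i.
Hypothesis B_hom : forall i, der_pdeg (d i) (B i).
Hypothesis heavy : (\sum_(j < k) m j <= 2 * m i0)%N.

Lemma basis_degree_sum : (\sum_i d i <= \sum_j m j)%N.
Proof.
have Q0 : defpoly a m predT != 0 by apply: defpoly_neq0.
have [t QE] := det_basis_mdivides a0 a_inj BD B_gen.
have D_hom : \det B \is (\sum_i d i)%N.-homog by apply: dhomog_det => i j; apply: B_hom.
move: Q0 (defpoly_homog a m predT); rewrite QE mulf_eq0 negb_or => /andP[D0 t0].
by case/(dhomog_mul_cancel D0 t0 D_hom).
Qed.

Lemma exists_good_basis_element :
  exists i1 c, c != 0 /\ der_app (B i1) (a i0) = c *: lin_form (a i0) ^+ m i0.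
Proof.
set L := lin_form (a i0) ^+ m i0.
have L0 : L != 0 by rewrite expf_neq0 // lin_form_eq0.
have [f fE] := fin_all_exists (fun i => BD i (isT : predT i0)).
suff [i /mpoly_unitP[c c0 fc]] : exists i, f i \is a GRing.unit.
  by exists i, c; split=> //; rewrite fE fc mulrC mul_mpolyC.
have Lhom : L \is (m i0).-homog.
  by have := dhomogMn (m i0) (lin_form_homog (a i0)); rewrite mul1n.
have f_hom i : f i != 0 -> (m i0 <= d i)%N /\ f i \is (d i - m i0).-homog.
  by move=> fi0; apply: (dhomog_mul_cancel L0 fi0 Lhom); rewrite -fE; apply: dhomog_der_app.
pose Q' := defpoly a m (fun j => j != i0).
have QE : defpoly a m predT = L * Q' by apply: defpolyD1.
have [v av] := exists_dot1 (a0 i0).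
(* Q times the constant derivation along v sends the form of [a i0] to Q, which is nonzero; hence
   some [f i] is nonzero. *)
have QD : inD a m predT (fun i => v 0 i *: (L * Q')).
  move=> j _; rewrite der_app_const; apply: mdividesZ; rewrite -QE.
  by eexists; apply: defpolyD1.
have [i1 fi1] : exists i, f i != 0.
  apply/existsP; apply/contraT => /existsPn f0; have [c cE] := B_gen QD.
  have := mulf_neq0 L0 (defpoly_neq0 m (P := fun j => j != i0) (fun j _ => a0 j)).
  rewrite -/Q' -[L * Q']scale1r -av -der_app_const (der_app_comb _ cE) big1 ?eqxx // => i _.
  by rewrite fE; move: (f0 i); rewrite negbK => /eqP ->; rewrite !mulr0.
have [fother|/existsPn f_not_unit] := boolP [exists i, f i \is a GRing.unit]; first exact/existsP.
have dlt i : f i != 0 -> (m i0 < d i)%N.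
  move=> fi; have [le_d hom] := f_hom _ fi; rewrite ltn_neqAle le_d andbT.
  apply: contra (f_not_unit i) => /eqP dE; apply: dhomog0_unit => //.
  by rewrite -dE subnn in hom.
(* Two indices with nonzero f would give a degree sum strictly above 2 m0, hence above |m|. *)
have f0 i : i != i1 -> f i = 0.
  move=> ii1; apply/eqP; apply: contraTT heavy => fi; rewrite -ltnNge.
  apply: leq_trans basis_degree_sum; rewrite (bigD1 i1) //= (bigD1 i) //= addnA.
  apply: leq_trans (leq_addr _ _); rewrite mul2n -addnn -addnS.
  by apply: leq_add; [apply: ltnW|]; apply: dlt.
(* This derivation sends the form of [a i0] to [L * g]; expanded in the basis, only the term with
   [f i1] survives. *)
have f_dvd w g : dot (a i0) w = 1 -> inD a m predT (fun i => w 0 i *: (L * g)) ->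
    mdivides (f i1) g.
  move=> aw /B_gen[c cE]; have := der_app_const (L * g) w (a i0).
  rewrite (der_app_comb _ cE) aw scale1r (bigD1 i1) //= big1 => [|i /f0 fi]; last first.
    by rewrite fE fi !mulr0.
  rewrite addr0 fE mulrCA => /(mulfI L0) <-.
  exact/mdivides_mull/mdivides_refl.
have [r Q'E] := f_dvd v Q' av QD.
exists i1; apply: (@unit_mdivides_unit _ _ _ 1); last exact: unitr1.
have : mdivides Q' r.
  apply: (@defpoly_mdivides_cancel _ _ _ a m _ (f i1)) => [//|j ji0|].
    pose P h := (h != i0) && (h != j).
    have gE : Q' = lin_form (a j) ^+ m j * defpoly a m P by apply: defpolyD1.
    (* Along w the form of [a j] is killed, so its power may be dropped from Q' without leaving
       D(A,m). Thus [f i1] divides a product prime to that form. *)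
    have [|w [aw ajw]] := exists_dot10 (a0 i0) (a0 j); first by apply: a_inj; rewrite eq_sym.
    move=> /mdivides_trans/(_ (f_dvd w (defpoly a m P) aw _)) ajP.
    have {ajP}/ajP : inD a m predT (fun i => w 0 i *: (L * defpoly a m P)).
      move=> h _; rewrite der_app_const.
      have [->|hj] := eqVneq h j; first by rewrite ajw scale0r; apply: mdivides0.
      apply: mdividesZ; have [->|hi0] := eqVneq h i0.
        by apply: mdivides_mulr; apply: mdivides_refl.
      apply: mdivides_mull; eexists; apply: defpolyD1; exact/andP.
    apply: not_mdivides_defpoly => // h /andP[_ hj]; apply: a_inj; by rewrite eq_sym.
  by rewrite -Q'E; apply: mdivides_refl.
case=> t rE; exists t; apply: (mulfI (defpoly_neq0 m (P := fun j => j != i0) (fun j _ => a0 j))).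
by rewrite -/Q' mulr1 {1}Q'E rE mulrCA.
Qed.

End Heavy.

(** * Linearity in the form, and the product over one parallelism class *)

Section DerAppLinear.
Variables (K : fieldType) (n : nat).
Implicit Types (th : der K n) (b : 'rV[K]_n).

Lemma der_appDr th b b' : der_app th (b + b') = der_app th b + der_app th b'.
Proof. by rewrite /der_app -big_split; apply: eq_bigr => i _; rewrite mxE scalerDl. Qed.

Lemma der_appZr th t b : der_app th (t *: b) = t *: der_app th b.
Proof. by rewrite scaler_sumr; apply: eq_bigr => i _; rewrite mxE scalerA. Qed.

Lemma sum_scale_mulmx r (V : lmodType K) (R : 'M[K]_(n, r)) (v : 'I_n -> V) (b : 'rV[K]_r) :
  \sum_s b 0 s *: (\sum_i R i s *: v i) = \sum_i (b *m R^T) 0 i *: v i.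
Proof.
under eq_bigr => s _ do rewrite scaler_sumr.
rewrite exchange_big; apply: eq_bigr => i _; rewrite mxE scaler_suml.
by apply: eq_bigr => s _; rewrite scalerA mxE.
Qed.

End DerAppLinear.

(** Forms in one class are scalar multiples of [b j]. When P excludes only [i0], the exponent is the
    Euler-Ziegler multiplicity. *)
Lemma defpoly_class (K : fieldType) n k (b : 'I_k -> 'rV[K]_n) m (P : pred 'I_k) j :
  (forall h, P h -> b h != 0) -> P j ->
  exists2 t, t != 0 & defpoly b m (fun h => P h && same_hyp (b h) (b j)) =
    t *: lin_form (b j) ^+ (\sum_(h | P h && same_hyp (b h) (b j)) m h).
Proof.
move=> b0 Pj; apply: (big_ind2 (fun p e => exists2 t, t != 0 & p = t *: lin_form (b j) ^+ e)).
- by exists 1; rewrite ?oner_neq0 // expr0 scale1r.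
- move=> p e q e' [t t0 ->] [u u0 ->]; exists (t * u); first exact: mulf_neq0.
  by rewrite exprD -scalerAr -scalerAl scalerA mulrC.
move=> h /andP[Ph]; rewrite same_hyp_sym => /(same_hypP (b0 j Pj) (b0 h Ph))[t t0 ->].
by exists (t ^+ m h); rewrite ?expf_neq0 // lin_formZ exprZn.
Qed.

(** * Independence and generation from a nonzero determinant *)

Section DeterminantBasis.
Variables (K : fieldType) (n : nat) (N : 'M[{mpoly K[n]}]_n).
Hypothesis detN0 : \det N != 0.

Lemma det_neq0_free (c : 'I_n -> {mpoly K[n]}) :
  (forall i, \sum_j c j * N j i = 0) -> forall j, c j = 0.
Proof.
move=> cN j; apply: (mulIf detN0); rewrite mul0r.
have /rowP/(_ j) : (\row_j c j) *m N *m \adj N = 0.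
  rewrite (_ : _ *m N = 0) ?mul0mx //; apply/rowP => i; rewrite !mxE -[RHS](cN i).
  by apply: eq_bigr => s _; rewrite mxE.
by rewrite -mulmxA mul_mx_adj mul_mx_scalar !mxE mulrC.
Qed.

(* Cramer's rule: det N * th = sum_r (det N with row r replaced by th) * N_r *)
Lemma cramer_generates (th : der K n) :
  (forall r, mdivides (\det N) (\det (\matrix_(i, s) if i == r then th s else N i s))) ->
  exists c : 'I_n -> {mpoly K[n]}, forall i, th i = \sum_j c j * N j i.
Proof.
move=> /fin_all_exists[c cE]; exists c => i; apply: (mulfI detN0).
have detE r : \det N * c r = \sum_s th s * \adj N s r.
  rewrite -cE (expand_det_row _ r); apply: eq_bigr => s _.
  rewrite [X in X * _]mxE eqxx [X in _ = _ * X]mxE.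
  rewrite /cofactor; congr (_ * (_ * \det _)); apply/matrixP => u v; rewrite !mxE.
  by rewrite eq_sym (negbTE (neq_lift _ _)).
transitivity (((\row_s th s) *m \adj N *m N) 0 i).
  by rewrite -mulmxA mul_adj_mx mul_mx_scalar !mxE.
rewrite mxE mulr_sumr; apply: eq_bigr => r _; rewrite mulrA detE mxE; congr (_ * _).
by apply: eq_bigr => s _; rewrite mxE.
Qed.

End DeterminantBasis.

(** * Restriction of polynomials to a parametrised subspace *)

Section Restriction.
Variables (K : fieldType) (n r : nat) (P : 'M[K]_(r, n)).

(** Pullback along y -> y P; when the rows of P form a basis of H_0, this is restriction to H_0 in
    those coordinates. *)
Definition restrict (p : {mpoly K[n]}) : {mpoly K[r]} :=
  p \mPo [tuple lin_form (\row_s P s i) | i < n].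

HB.instance Definition _ := GRing.RMorphism.copy restrict
  (comp_mpoly [tuple lin_form (\row_s P s i) | i < n]).

Lemma restrict_lin_form a : restrict (lin_form a) = lin_form (a *m P^T).
Proof.
rewrite /restrict raddf_sum /=.
under eq_bigr => i _ do rewrite comp_mpolyZ comp_mpolyXU -tnth_nth tnth_mktuple scaler_sumr.
rewrite exchange_big; apply: eq_bigr => s _; rewrite mxE scaler_suml.
by apply: eq_bigr => i _; rewrite !mxE scalerA.
Qed.

Lemma restrict_mdivides p q : mdivides p q -> mdivides (restrict p) (restrict q).
Proof. by case=> t ->; exists (restrict t); rewrite rmorphM. Qed.

Lemma restrict_defpoly k (a : 'I_k -> 'rV[K]_n) m Q :
  restrict (defpoly a m Q) = defpoly (fun j => a j *m P^T) m Q.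
Proof. by rewrite rmorph_prod; apply: eq_bigr => j _; rewrite rmorphXn /= restrict_lin_form. Qed.

Lemma restrict_der_app th a : restrict (der_app th a) = \sum_i a 0 i *: restrict (th i).
Proof. by rewrite /restrict raddf_sum; apply: eq_bigr => i _; apply: comp_mpolyZ. Qed.

Lemma restrict_homog d p : p \is d.-homog -> restrict p \is d.-homog.
Proof.
move=> p_hom; rewrite /restrict comp_mpolyEX big_seq; apply: rpred_sum => e pe.
apply: dhomogZ; rewrite -(dhomog_mf p_hom pe) comp_mpolyX /= mdegE.
apply: (big_ind2 (fun p e => p \is e.-homog)) => [|q u q' u'|i _]; first exact: dhomog1.
  exact: dhomogM.
by rewrite tnth_mktuple -[X in X.-homog]mul1n; apply/dhomogMn/lin_form_homog.
Qed.

End Restriction.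

(** * Coordinates adapted to a hyperplane *)

Section HyperplaneSplitting.
Variables (K : fieldType) (n : nat) (P : 'M[K]_(n, n.+1)) (a : 'rV[K]_n.+1).
Hypotheses (P_free : row_free P) (Pa : P *m a^T = 0) (a0 : a != 0).

(** Take w with [dot a w = 1], and let R read off the P-coordinates of the component in ker a along
    w. Then w stacked on P and [a^T] beside R are inverse square matrices. *)
Lemma hyperplane_splitting : exists w (R : 'M[K]_(n.+1, n)), a^T *m w + R *m P = 1%:M.
Proof.
have [w aw] := exists_dot1 a0; have aw1 : w *m a^T = 1%:M by rewrite dotE aw.
pose R := (1%:M - a^T *m w) *m pinvmx P; exists w, R.
have wR : w *m R = 0 by rewrite /R mulmxA mulmxBr mulmx1 (mulmxA w) aw1 mul1mx subrr mul0mx.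
have PR : P *m R = 1%:M.
  by rewrite /R mulmxA mulmxBr mulmx1 (mulmxA P) Pa mul0mx subr0 mulmxVp.
have : col_mx w P *m row_mx a^T R = 1%:M.
  by rewrite mul_col_row aw1 wR Pa PR -scalar_mx_block.
by move/mulmx1C; rewrite mul_row_col.
Qed.

Variables (w : 'rV[K]_n.+1) (R : 'M[K]_(n.+1, n)).
Hypothesis wR : a^T *m w + R *m P = 1%:M.

Lemma split_row b : b = dot b w *: a + b *m P^T *m R^T.
Proof.
apply: trmx_inj; rewrite -[LHS]mul1mx -wR mulmxDl linearD /= !trmx_mul !trmxK -!mulmxA.
by rewrite dotE mul_mx_scalar linearZ.
Qed.

(** Column s of R is a linear form on V extending the s-th coordinate of the hyperplane; th is
    applied to this extension and the result restricted. *)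
Definition restrict_der (th : der K n.+1) : der K n :=
  fun s => \sum_i R i s *: restrict P (th i).

(** By [split_row], b differs from the extension of its restriction by a multiple of a, which th
    kills. *)
Lemma restrict_der_appE th b : der_app th a = 0 ->
  der_app (restrict_der th) (b *m P^T) = restrict P (der_app th b).
Proof.
move=> tha; rewrite [LHS]sum_scale_mulmx -restrict_der_app [in RHS](split_row b).
by rewrite der_appDr der_appZr tha scaler0 add0r.
Qed.

(* Changing to coordinates adapted to ker a, expand along the column of the values at a. *)
Lemma det_adapted (B : 'M[{mpoly K[n.+1]}]_n.+1) i1 q :
  der_app (B i1) a = q -> (forall i, i != i1 -> der_app (B i) a = 0) ->
  mdivides (q * \det (\matrix_(r, s) \sum_i R i s *: B (lift i1 r) i)) (\det B).
Proof.
move=> Bq B0; set N := \matrix_(r, s) _.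
(* [Mi] has column blocks [a^T] and R, [M] has row blocks w and P; index [ord0] carries the
   direction off the hyperplane. *)
pose Mi : 'M[K]_n.+1 := \matrix_(i, s) if unlift ord0 s is Some t then R i t else a 0 i.
pose M : 'M[K]_n.+1 := \matrix_(s, i) if unlift ord0 s is Some t then P t i else w 0 i.
have MiM : Mi *m M = 1%:M.
  rewrite -wR; apply/matrixP => i s; rewrite !mxE big_ord_recl big_ord1 !mxE unlift_none.
  by congr (_ + _); apply: eq_bigr => t _; rewrite !mxE liftK.
pose X := B *m map_mx (@mpolyC n.+1 K) Mi.
have XM : B = X *m map_mx (@mpolyC n.+1 K) M.
  by rewrite -mulmxA -map_mxM MiM map_mx1 mulmx1.
have X0 i : X i ord0 = der_app (B i) a.
  rewrite mxE; apply: eq_bigr => s _; by rewrite !mxE unlift_none mulrC mul_mpolyC.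
have -> : \det B = \det X * \det (map_mx (@mpolyC n.+1 K) M) by rewrite -det_mulmx -XM.
apply: mdivides_mulr; rewrite (expand_det_col _ ord0) (bigD1 i1) //= big1 => [|i ii1]; last first.
  by rewrite X0 B0 // mul0r.
rewrite addr0 X0 Bq /cofactor mulrCA; apply: mdivides_mull.
rewrite (_ : row' i1 (col' ord0 X) = N); first exact: mdivides_refl.
apply/matrixP => u v; rewrite !mxE; apply: eq_bigr => i _.
by rewrite !mxE liftK mulrC mul_mpolyC.
Qed.

End HyperplaneSplitting.

(** * The Euler-Ziegler restriction and its basis *)

Section EulerZieglerRestriction.
Variables (K : fieldType) (n k : nat) (a : 'I_k -> 'rV[K]_n.+1) (m : 'I_k -> nat).
Hypothesis a0 : forall j, a j != 0.
Hypothesis a_inj : forall i j, i != j -> ~~ same_hyp (a i) (a j).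
Variables (i0 : 'I_k) (P : 'M[K]_(n, n.+1)).
Variables (w : 'rV[K]_n.+1) (R : 'M[K]_(n.+1, n)).
Hypothesis wR : (a i0)^T *m w + R *m P = 1%:M.

Let b j := a j *m P^T.

Lemma restrict_arr_neq0 j : j != i0 -> b j != 0.
Proof.
move=> /a_inj; apply: contra => /eqP bj0.
have aE := split_row wR (a j); rewrite [a j *m _]bj0 mul0mx addr0 in aE.
rewrite same_hyp_sym; apply/same_hypP => //; exists (dot (a j) w) => //.
by apply: contraNneq (a0 j) => c0; rewrite aE c0 scale0r.
Qed.

(** If [b h] and [b j] are proportional, then [a j] is a multiple of [a h] modulo [a i0], which th
    kills. So the powers for the whole class of j divide th on [a j], and their product restricts to
    the Euler-Ziegler power up to a scalar. *)
Lemma restrict_inD th : inD a m predT th -> der_app th (a i0) = 0 ->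
  inD b (ez_mult b m i0) (fun j => j != i0) (restrict_der P R th).
Proof.
move=> thD th0 j ji0; rewrite (restrict_der_appE wR) //.
have [t t0 tE] := defpoly_class m (P := fun j => j != i0) restrict_arr_neq0 ji0.
rewrite /ez_mult -[_ ^+ _](scalerK t0) -tE.
apply: (@mdivides_unitM _ _ _ _ 1); rewrite ?unitr1 // mul1r.
have [s ->] : mdivides (defpoly b m (fun h => (h != i0) && same_hyp (b h) (b j)))
    (restrict P (der_app th (a j))).
  rewrite -restrict_defpoly; apply: restrict_mdivides; apply: defpoly_mdivides => // h.
  case/andP=> hi0 /(same_hypP (restrict_arr_neq0 hi0) (restrict_arr_neq0 ji0))[u _ bE].
  rewrite (split_row wR (a j)) [a j *m _]bE -scalemxAl.
  have -> : b h *m R^T = a h - dot (a h) w *: a i0.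
    by apply/eqP; rewrite eq_sym subr_eq addrC; apply/eqP/(split_row wR).
  rewrite -scaleNr !(der_appDr, der_appZr) th0 !scaler0 add0r addr0.
  exact/mdividesZ/thD.
by exists (t *: s); rewrite -scalerAl -scalerAr scalerA mulVf // scale1r.
Qed.

(** Class by class, the product is the Euler-Ziegler power up to a scalar, and [mdivides_det]
    applies to it. *)
Lemma restrict_defpoly_mdivides_det (N : 'M[{mpoly K[n]}]_n) :
  (forall i, inD b (ez_mult b m i0) (fun j => j != i0) (N i)) ->
  mdivides (defpoly b m (fun j => j != i0)) (\det N).
Proof.
move=> ND; apply: defpoly_mdivides_classes => [|j ji0]; first exact: restrict_arr_neq0.
have [t t0 ->] := defpoly_class m (P := fun j => j != i0) restrict_arr_neq0 ji0.
have [s ->] := mdivides_det (restrict_arr_neq0 ji0) (fun i => ND i j ji0).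
by exists (t^-1 *: s); rewrite -scalerAl -scalerAr scalerA mulfV // scale1r.
Qed.

Variables (B : 'M[{mpoly K[n.+1]}]_n.+1) (d : 'I_n.+1 -> nat) (i1 : 'I_n.+1) (c : K).
Hypothesis BD : forall i, inD a m predT (B i).
Hypothesis B_gen : forall th, inD a m predT th ->
  exists c : 'I_n.+1 -> {mpoly K[n.+1]}, forall i, th i = \sum_j c j * B j i.
Hypothesis B_hom : forall i, der_pdeg (d i) (B i).
Hypotheses (c0 : c != 0) (Bi1 : der_app (B i1) (a i0) = c *: lin_form (a i0) ^+ m i0).

Lemma good_basis_degree : d i1 = m i0.
Proof.
have L0 : c *: lin_form (a i0) ^+ m i0 != 0.
  by rewrite scaler_eq0 negb_or c0 expf_neq0 ?lin_form_eq0.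
apply: (@dhomog_uniq _ _ mdeg _ _ _ L0); first by rewrite -Bi1; apply: dhomog_der_app.
by apply: dhomogZ; have := dhomogMn (m i0) (lin_form_homog (a i0)); rewrite mul1n.
Qed.

Lemma adapted_basis : exists B' : 'M[{mpoly K[n.+1]}]_n.+1,
  [/\ B' i1 =1 B i1, forall i, i != i1 -> der_app (B' i) (a i0) = 0,
      forall i, inD a m predT (B' i), forall i, der_pdeg (d i) (B' i)
    & mdivides (\det B') (\det B)].
Proof.
have [f fE] := fin_all_exists (fun i => BD i (isT : predT i0)).
have BL := Bi1; set L := lin_form (a i0) ^+ m i0 in BL fE.
have L0 : L != 0 by rewrite expf_neq0 // lin_form_eq0.
(* Off [i1] this is the quotient of the values of [B i] and [B i1] on [a i0]; the value 0 at [i1]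
   keeps that row unchanged. *)
pose g i : {mpoly K[n.+1]} := if i == i1 then 0 else c^-1 *: f i.
have gi1 : g i1 = 0 by rewrite /g eqxx.
have der_appB i b' : der_app (fun s => B i s - g i * B i1 s) b' =
    der_app (B i) b' - g i * der_app (B i1) b'.
  rewrite -der_appZ -sumrB; apply: eq_bigr => s _; exact: scalerBr.
pose B' : 'M_n.+1 := \matrix_(i, s) (B i s - g i * B i1 s).
have B'E i b' : der_app (B' i) b' = der_app (B i) b' - g i * der_app (B i1) b'.
  by rewrite -der_appB; apply: eq_bigr => s _; rewrite mxE.
exists B'; split=> [s|i ii1|i j _|i s|].
- by rewrite mxE gi1 mul0r subr0.
- rewrite B'E BL fE /g (negbTE ii1) -scalerAl -scalerAr scalerA mulVf // scale1r.
  by rewrite mulrC subrr.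
- by rewrite B'E; apply: mdividesB; [|apply: mdivides_mull]; apply: BD.
- rewrite homog_degE mxE rpredB //; first exact: B_hom.
  rewrite /g; case: eqP => _; first by rewrite mul0r dhomog0.
  have [->|fi0] := eqVneq (f i) 0; first by rewrite scaler0 mul0r dhomog0.
  have Lhom : L \is (m i0).-homog.
    by have := dhomogMn (m i0) (lin_form_homog (a i0)); rewrite mul1n.
  have Lf_hom : L * f i \is (d i).-homog by rewrite -fE; apply: dhomog_der_app.
  have [md fhom] := dhomog_mul_cancel L0 fi0 Lhom Lf_hom.
  rewrite -(subnK md) -good_basis_degree; apply: dhomogM; last exact: B_hom.
  by apply: dhomogZ; rewrite good_basis_degree.
(* C undoes the row operations: row i of B is row i of B' plus [g i] times row [i1] of B'. *)
pose C : 'M[{mpoly K[n.+1]}]_n.+1 := \matrix_(i, j) ((i == j)%:R + g i * (j == i1)%:R).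
suff -> : B = C *m B' by rewrite det_mulmx; apply/mdivides_mull/mdivides_refl.
apply/matrixP => i s; rewrite mxE; under eq_bigr => j _ do rewrite mxE mulrDl.
rewrite big_split /= (bigD1 i) //= [X in _ + X + _]big1 => [|j /negbTE ji]; last first.
  by rewrite eq_sym ji mul0r.
rewrite (bigD1 i1) //= [X in _ + (_ + X)]big1 => [|j /negbTE ji]; last first.
  by rewrite ji mulr0 mul0r.
by rewrite !eqxx mul1r mulr1 !addr0 !mxE gi1 mul0r subr0 subrK.
Qed.

Lemma restriction_free :
  free_with_exp (inD b (ez_mult b m i0) (fun j => j != i0)) [seq d (lift i1 r) | r : 'I_n].
Proof.
split; first by rewrite size_image card_ord.
have [B' [B'i1 B'0 B'D B'_hom B'B]] := adapted_basis.
pose N : 'M[{mpoly K[n]}]_n := \matrix_(r, s) restrict_der P R (B' (lift i1 r)) s.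
have NE r s : N r s = restrict_der P R (B' (lift i1 r)) s by rewrite mxE.
have ND r : inD b (ez_mult b m i0) (fun j => j != i0) (N r).
  move=> j ji0; have := restrict_inD (B'D (lift i1 r)) _ ji0.
  rewrite /der_app; under [X in _ -> mdivides _ X]eq_bigr => s _ do rewrite NE.
  by apply; apply: B'0; rewrite eq_sym neq_lift.
have detN : mdivides (\det N) (defpoly b m (fun j => j != i0)).
  pose L := lin_form (a i0) ^+ m i0.
  have L0 : L != 0 by rewrite expf_neq0 // lin_form_eq0.
  have B'L : der_app (B' i1) (a i0) = c *: L.
    by rewrite -Bi1; apply: eq_bigr => s _; rewrite B'i1.
  pose N' : 'M[{mpoly K[n.+1]}]_n := \matrix_(r, s) \sum_i R i s *: B' (lift i1 r) i.
  (* Up to the scalar c, [L * \det N'] divides [\det B'], hence [\det B], hence Q; then L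
     cancels. *)
  have N'Q : mdivides (\det N') (defpoly a m (fun j => j != i0)).
    have QE : defpoly a m predT = L * defpoly a m (fun j => j != i0) by apply: defpolyD1.
    apply: (mdivides_mul2l L0); rewrite -QE.
    apply: mdivides_trans (det_basis_mdivides a0 a_inj BD B_gen).
    apply: mdivides_trans B'B; apply: mdivides_trans (det_adapted wR B'L B'0).
    by rewrite -scalerAl; apply: mdividesZ; apply: mdivides_refl.
  have := restrict_mdivides P N'Q; rewrite restrict_defpoly -det_map_mx /=.
  rewrite (_ : map_mx _ N' = N) //; apply/matrixP => r s; rewrite !mxE /restrict raddf_sum.
  by apply: eq_bigr => i _; apply: comp_mpolyZ.
have detN0 : \det N != 0.
  have [t QE] := detN; have := defpoly_neq0 m restrict_arr_neq0.
  by rewrite QE mulf_eq0 negb_or => /andP[].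
exists N; split=> [//|r s|th thD|cf].
- rewrite (nth_map r) ?size_enum_ord // nth_ord_enum mxE homog_degE.
  apply: rpred_sum => i _; apply: dhomogZ; apply: restrict_homog; exact: B'_hom.
- apply: cramer_generates => // r.
  (* Replacing a row of N by an element of the restricted module leaves a family in that module. *)
  apply: mdivides_trans detN _; apply: restrict_defpoly_mdivides_det => i j ji0.
  rewrite /der_app; under eq_bigr => s _ do rewrite mxE.
  by case: eqP => _; [apply: thD | apply: ND].
exact: det_neq0_free.
Qed.

End EulerZieglerRestriction.

(** * Assembling the good summand, the exponents and the restriction *)

Theorem theorem3p4 (K : fieldType) (l k : nat)
  (alpha : 'I_k -> 'rV[K]_l) (m : 'I_k -> nat) (d : seq nat) (i0 : 'I_k) :
  (forall j, alpha j != 0) ->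
  (forall j, (0 < m j)%N) ->
  (forall i j, i != j -> ~~ same_hyp (alpha i) (alpha j)) ->
  free_with_exp (inD alpha m predT) d ->
  (\sum_(j < k) m j <= 2 * m i0)%N ->
  (exists th0 : der K l,
      [/\ inD alpha m predT th0, der_pdeg (m i0) th0
        & der_app th0 (alpha i0) = lin_form (alpha i0) ^+ m i0])
  /\
  exists d' : seq nat,
    perm_eq d (m i0 :: d') /\
    forall P : 'M[K]_(l.-1, l),
      row_free P -> P *m (alpha i0)^T = 0 ->
      let beta := fun j => alpha j *m P^T in
      free_with_exp (inD beta (ez_mult beta m i0) (fun j => j != i0)) d'.
Proof.
move=> a0 _ a_inj [d_size [B0 [B0D B0_hom B0_gen _]]] heavy.
(* Dimension 0 is excluded because [alpha i0] is a nonzero vector. *)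
case: l => [|n] in alpha a0 a_inj d_size B0 B0D B0_hom B0_gen *.
  by case/rV0Pn: (a0 i0) => - [].
pose B : 'M_n.+1 := \matrix_(i, s) B0 i s.
have BE i s : B i s = B0 i s by rewrite mxE.
have appE i b : der_app (B i) b = der_app (B0 i) b.
  by apply: eq_bigr => s _; rewrite BE.
have BD i : inD alpha m predT (B i) by move=> j jT; rewrite appE; apply: B0D.
pose e (i : 'I_n.+1) := nth 0%N d i.
have B_hom i : der_pdeg (e i) (B i) by move=> s; rewrite BE; apply: B0_hom.
have B_gen th : inD alpha m predT th ->
    exists c : 'I_n.+1 -> {mpoly K[n.+1]}, forall i, th i = \sum_j c j * B j i.
  move=> /B0_gen[c cE]; exists c => i; rewrite cE.
  by apply: eq_bigr => j _; rewrite BE.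
have [i1 [c [c0 Bi1]]] := exists_good_basis_element a0 a_inj BD B_gen B_hom heavy.
have di1 := good_basis_degree a0 B_hom c0 Bi1.
split.
  exists (fun s => c^-1 *: B i1 s).
  have thE b : der_app (fun s => c^-1 *: B i1 s) b = c^-1 *: der_app (B i1) b.
    by rewrite scaler_sumr; apply: eq_bigr => s _; rewrite !scalerA mulrC.
  split=> [j jT|s|].
  - by rewrite thE; apply: mdividesZ; apply: BD.
  - by rewrite homog_degE; apply: dhomogZ; rewrite -di1; apply: B_hom.
  by rewrite thE Bi1 scalerA mulVf ?scale1r.
(* [lift i1] enumerates the indices other than [i1], so this is d with one entry m0 removed. *)
exists [seq e (lift i1 r) | r : 'I_n]; split.
  have -> : d = [seq e i | i : 'I_n.+1].
    apply: (@eq_from_nth _ 0%N) => [|i]; first by rewrite size_image card_ord.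
    rewrite d_size => i_lt; rewrite (nth_map ord0) ?size_enum_ord //.
    by rewrite /e nth_enum_ord.
  have -> : m i0 :: [seq e (lift i1 r) | r : 'I_n] =
      [seq e i | i <- i1 :: map (lift i1) (enum 'I_n)].
    by rewrite /= -map_comp -di1.
  apply/perm_map/uniq_perm => [||i]; first exact: enum_uniq.
    rewrite /= map_inj_uniq ?enum_uniq ?andbT; last exact: lift_inj.
    by apply/mapP => - [r _ /eqP]; rewrite (negbTE (neq_lift _ _)).
  rewrite mem_enum in_cons; have [r ->|->] := unliftP i1 i; last by rewrite eqxx.
  by rewrite map_f ?mem_enum ?orbT.
move=> P P_free Pa.
have [w [R wR]] := hyperplane_splitting P_free Pa (a0 i0).
exact: (restriction_free a0 a_inj wR BD B_gen B_hom c0 Bi1).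
Qed.
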